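(* Let $(X,\mathcal{B})$ be an uncountable standard Borel space, let $Aut(X,\mathcal{B})$ be the group of all Borel automorphisms of $(X,\mathcal{B})$ endowed with the weak topology $p$, and let $\mathcal{S}\subset Aut(X,\mathcal{B})$ be the set of smooth automorphisms. Then the $p$-closure of $\mathcal{S}$ is the whole group: $\overline{\mathcal{S}}^{\,p}=Aut(X,\mathcal{B})$. Moreover, every $p$-neighborhood of an aperiodic automorphism contains an automorphism that is both aperiodic and smooth.
   Context: A Borel automorphism of $(X,\mathcal{B})$ is a bijection $T:X\to X$ such that $T$ and $T^{-1}$ are Borel. The topology $p$ on $Aut(X,\mathcal{B})$ is defined by the base of neighborhoods $W(T;F_1,\ldots,F_n)=\{S\in Aut(X,\mathcal{B}) : SF_i=TF_i,\ i=1,\ldots,n\}$, where $T\in Aut(X,\mathcal{B})$, $n\in\mathbb{N}$ and $F_1,\ldots,F_n\in\mathcal{B}$. An automorphism $T$ is aperiodic if every $T$-orbit $\{T^nx : n\in\mathbb{Z}\}$ is infinite. An automorphism $T$ is smooth if there is a Borel set $A\subset X$ which meets every $T$-orbit exactly once. *)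

(* Defs.v *)
From HB Require Import structures.
From mathcomp Require Import all_boot all_order all_algebra.
From mathcomp Require Import all_classical all_reals all_analysis.

Set Implicit Arguments.
Unset Strict Implicit.
Unset Printing Implicit Defensive.

Local Open Scope classical_set_scope.

Definition complete_metric (R : realType) (Y : metricType R) : Prop :=
  forall F : set_system Y, ProperFilter F -> cauchy F -> exists y : Y, F --> y.

Definition separable (Y : topologicalType) : Prop :=
  exists2 D : set Y, countable D & dense D.

(* The measurable space X is Borel isomorphic to a Polish space Y: the last
   clause says that both f and its inverse are Borel. *)
Definition standard_borel (R : realType) d (X : measurableType d) : Prop :=
  exists (Y : metricType R) (f : X -> Y),
    [/\ complete_metric Y, separable Y, bijective f &
        forall B : set Y, <<s open >> B <-> measurable (f @^-1` B)].

Record borel_aut d (X : measurableType d) := BorelAut {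
  aut_fun :> X -> X ;
  aut_inv : X -> X ;
  aut_funK : cancel aut_fun aut_inv ;
  aut_invK : cancel aut_inv aut_fun ;
  measurable_aut_fun : measurable_fun [set: X] aut_fun ;
  measurable_aut_inv : measurable_fun [set: X] aut_inv }.

Section BorelAutGroup.
Context d (X : measurableType d).
Implicit Types S T U : borel_aut X.

Lemma borel_autP S T : (forall x, S x = T x) -> S = T.
Proof.
case: S T => [f g fK gK mf mg] [f' g' fK' gK' mf' mg'] /= ff'.
have {}ff' : f = f' by apply/funext.
case: _ / ff' in fK' gK' mf' *.
have gg' : g = g' by apply/funext => x; rewrite -{1}(gK' x) fK.
case: _ / gg' in fK' gK' mg' *.
by congr BorelAut; exact: Prop_irrelevance.
Qed.

Definition aut_one : borel_aut X :=
  @BorelAut d X id id (fun=> erefl) (fun=> erefl)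
    (@measurable_id _ _ _) (@measurable_id _ _ _).

Definition aut_opp T : borel_aut X :=
  BorelAut (@aut_invK _ _ T) (@aut_funK _ _ T)
    (@measurable_aut_inv _ _ T) (@measurable_aut_fun _ _ T).

Definition aut_comp S T : borel_aut X :=
  BorelAut (can_comp (@aut_funK _ _ S) (@aut_funK _ _ T))
    (can_comp (@aut_invK _ _ T) (@aut_invK _ _ S))
    (measurableT_comp (@measurable_aut_fun _ _ S) (@measurable_aut_fun _ _ T))
    (measurableT_comp (@measurable_aut_inv _ _ T) (@measurable_aut_inv _ _ S)).

HB.instance Definition _ := gen_eqMixin (borel_aut X).
HB.instance Definition _ := gen_choiceMixin (borel_aut X).
HB.instance Definition _ := isPointed.Build (borel_aut X) aut_one.

Fact aut_compA : associative aut_comp.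
Proof. by move=> S T U; apply: borel_autP. Qed.
Fact aut_comp1l : left_id aut_one aut_comp.
Proof. by move=> T; apply: borel_autP. Qed.
Fact aut_comp1r : right_id aut_one aut_comp.
Proof. by move=> T; apply: borel_autP. Qed.
Fact aut_compVl : left_inverse aut_one aut_opp aut_comp.
Proof. by move=> T; apply: borel_autP => x; exact: aut_funK. Qed.
Fact aut_compVr : right_inverse aut_one aut_opp aut_comp.
Proof. by move=> T; apply: borel_autP => x; exact: aut_invK. Qed.

HB.instance Definition _ := isGroup.Build (borel_aut X)
  aut_compA aut_comp1l aut_comp1r aut_compVl aut_compVr.

End BorelAutGroup.

(* W(T; F_0, ..., F_(n-1)); the values F i with n <= i are irrelevant. *)
Definition p_nbhd d (X : measurableType d) (T : borel_aut X) (n : nat)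
    (F : nat -> set X) : set (borel_aut X) :=
  [set S | forall i, (i < n)%N -> S @` F i = T @` F i].

Section PTopology.
Context d (X : measurableType d).

Let I : pointedType := (borel_aut X * (nat * (nat -> set X)))%type.
Let D : set I := [set k | forall i, (i < k.2.1)%N -> measurable (k.2.2 i)].
Let b (k : I) : set (borel_aut X) := p_nbhd k.1 k.2.1 k.2.2.

Fact p_base_cover : \bigcup_(k in D) b k = setT.
Proof. by apply/seteqP; split=> // T _; exists (T, (0%N, point)). Qed.

Fact p_base_join k l T : D k -> D l -> b k T -> b l T ->
  exists m, [/\ D m, b m T & b m `<=` b k `&` b l].
Proof.
move=> Dk Dl bk bl.
exists (T, ((k.2.1 + l.2.1)%N,
  fun i => if (i < k.2.1)%N then k.2.2 i else l.2.2 (i - k.2.1)%N)).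
split=> //= [i /= ikl|S /= bS].
  case: ltnP => [/Dk//|ki]; apply: Dl.
  by rewrite ltn_subLR.
split=> i ilt /=.
- by rewrite -(bk i ilt); have := bS i (ltn_addr _ ilt); rewrite /= ilt.
- rewrite -(bl i ilt); have := bS (k.2.1 + i)%N.
  by rewrite /= ltn_add2l ilt ltnNge leq_addr /= addKn; exact.
Qed.

(* The topology p. *)
HB.instance Definition _ := isBaseTopological.Build (borel_aut X)
  p_base_cover p_base_join.

Lemma p_nbhsP (T : borel_aut X) (V : set (borel_aut X)) :
  nbhs T V <-> exists n (F : nat -> set X),
    (forall i, (i < n)%N -> measurable (F i)) /\ p_nbhd T n F `<=` V.
Proof.
split.
- rewrite nbhsE => -[U [[D' D'D <-]] [k D'k bkT] UV].
  exists k.2.1, k.2.2; split; first exact: D'D.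
  move=> S TS; apply: UV; exists k => // i ik.
  by rewrite TS// bkT.
- move=> [n [F [mF FV]]]; rewrite nbhsE; exists (p_nbhd T n F) => //.
  split=> //; exists [set ((T, (n, F)) : I)].
    by move=> _ ->.
  by rewrite bigcup_set1.
Qed.

End PTopology.

Definition aut_expz d (X : measurableType d) (T : borel_aut X) (n : int) :
    borel_aut X :=
  match n with Posz m => (T ^+ m)%g | Negz m => (T ^- m.+1)%g end.

Definition aut_orbit d (X : measurableType d) (T : borel_aut X) (x : X) : set X :=
  [set aut_expz T n x | n in [set: int]].

Definition aperiodic d (X : measurableType d) : set (borel_aut X) :=
  [set T | forall x : X, infinite_set (aut_orbit T x)].

Definition smooth d (X : measurableType d) : set (borel_aut X) :=
  [set T | exists2 A : set X, measurable A &
    forall x : X, exists! y, (A `&` aut_orbit T x) y].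
Arguments aperiodic {d} X.
Arguments smooth {d} X.

(* Main.v *)
Require Import Defs.
From mathcomp Require Import all_boot all_order all_algebra.
From mathcomp Require Import all_classical all_reals all_analysis.
From mathcomp Require Import lra.

(** Fix [T] and Borel sets [F_0, ..., F_(n-1)], and colour each point [x] by the
set [a x] of those [i] with [F_i x].  An automorphism [S] lies in the basic
neighbourhood of [T] as soon as [a (T^-1 (S x)) = a x] for every [x].  So if
[col x] is the pair of colours of [x] and of [T^-1 x], the only constraint on
[S] is that the second component of [col (S x)] be the first one of [col x]:
the sequence of values of [col] along an [S]-orbit must obey the same local
rule as along a [T]-orbit, but there is no relation between the orbits
themselves.

The values of [col] that are taken only countably often are taken inside a
countable [T]-invariant set [M].  There [S] is [T]: every subset of [M] is
Borel, so [M] contributes a transversal picked arbitrarily.  On the complement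
[W] of [M], each value [e] of [col] is either not taken or taken on an
uncountable Borel set [W_e].  Choose [r e] in [W_e] and use the [T]-orbit of
[r e] as a pattern: [W] is partitioned into Borel pieces [B (e, n)], with [n]
an integer, such that [B (e, n)] is an uncountable part of the set where [col]
is [col (T^n (r e))].  All pieces are uncountable, hence all are Borel
isomorphic to [X], and [S] maps [B (e, n)] to [B (e, n + 1)] through these
isomorphisms.  It respects the local rule because the orbit of [r e] does; it
is aperiodic on [W], and the union of the pieces [B (e, 0)] is a transversal
there ([smooth_modification]).

What this uses from descriptive set theory is that every uncountable Borel
subset [A] of [X] is Borel isomorphic to [X] ([borel_isomorphism]).  Borel sets
are projections of closed subsets of the product of the Baire space with [X]
([measurable_suslin]).  A Cantor scheme in such a closed set embeds the space
of binary sequences into [A] ([cantor_embedding]), whereas [X] is coded by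
binary sequences through its basic balls ([cantor_coding]); composing both
gives a Borel injection of [X] into [A] with a Borel left inverse
([borel_embedding]), and the Schroeder-Bernstein argument makes it onto.
Finally an uncountable Borel set splits into as many uncountable Borel pieces
as desired ([uncountable_partition]), since an injection of [X] into the
complement of an uncountable Borel set moves that set to infinitely many
disjoint copies of itself. *)

Set Implicit Arguments.
Unset Strict Implicit.
Unset Printing Implicit Defensive.
Import Order.TTheory GRing.Theory Num.Theory.
Local Open Scope classical_set_scope.
Local Open Scope ring_scope.

(** * Countable operations on measurable sets *)

Lemma sigma_algebra_bigcupT T (G : set (set T)) (I : countType) (F : I -> set T) :
  sigma_algebra setT G -> (forall i, G (F i)) -> G (\bigcup_i F i).
Proof.
move=> [G0 _ GU] GF.
rewrite [X in G X](_ : _ = \bigcup_n oapp F set0 (unpickle n)).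
  by apply: GU => n; case: unpickle => /=.
apply/seteqP; split=> [x [i _ Fx]|x [n _]].
  by exists (pickle i) => //; rewrite pickleK.
by case: unpickle => //= i Fx; exists i.
Qed.

Lemma measurable_bigcupT d (T : measurableType d) (I : countType) (F : I -> set T) :
  (forall i, measurable (F i)) -> measurable (\bigcup_i F i).
Proof.
by apply: sigma_algebra_bigcupT; split=> // [A mA|];
  [exact: measurableD|exact: bigcupT_measurable].
Qed.

Lemma measurable_bigcapT d (T : measurableType d) (I : countType) (F : I -> set T) :
  (forall i, measurable (F i)) -> measurable (\bigcap_i F i).
Proof.
move=> mF; rewrite -[X in measurable X]setCK setC_bigcap; apply: measurableC.
by apply: measurable_bigcupT => i; exact: measurableC.
Qed.

Lemma measurable_preimage d d' (T : measurableType d) (U : measurableType d')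
    (f : T -> U) (B : set U) :
  measurable_fun setT f -> measurable B -> measurable (f @^-1` B).
Proof. by move=> mf mB; rewrite -[X in measurable X]setTI; exact: mf. Qed.

Lemma measurable_cond d (T : measurableType d) (A : set T) (P : Prop) :
  measurable A -> measurable [set x | A x /\ P].
Proof.
move=> mA; have [p|np] := pselect P.
  by rewrite (_ : [set x | _] = A)//; apply/seteqP; split=> x // [].
by rewrite (_ : [set x | _] = set0)//; apply/seteqP; split=> x // [].
Qed.

Lemma uncountable_bigcup T (I : countType) (F : I -> set T) (A : set T) :
  A `<=` \bigcup_i F i -> ~ countable A -> exists i, ~ countable (F i).
Proof.
move=> AF nA; apply: contrapT => /forallNP cF; apply: nA.
apply: (@sub_countable _ _ _ (\bigcup_i F i)); first exact: subset_card_le.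
by apply: bigcup_countable => // i _; apply: contrapT; exact: cF.
Qed.

Lemma measurable_fun_glue d d' (T : measurableType d) (U : measurableType d')
    (I : countType) (k : T -> I) (F : I -> T -> U) :
  (forall i, measurable [set t | k t = i]) ->
  (forall i, measurable_fun setT (F i)) ->
  measurable_fun setT (fun t => F (k t) t).
Proof.
move=> mk mF _ B mB; rewrite setTI.
rewrite [X in measurable X](_ : _ = \bigcup_i ([set t | k t = i] `&` F i @^-1` B)).
  by apply: measurable_bigcupT => i; apply: measurableI => //; exact: measurable_preimage.
by apply/seteqP; split=> [t /= ?|t [i _ [/= <-]]]; first by exists (k t).
Qed.

Lemma countable_inj_image T U (f : T -> U) (A : set T) : injective f ->
  countable (f @` A) -> countable A.
Proof.
move=> finj /countable_injP[h hinj]; apply/countable_injP; exists (h \o f).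
move=> x y; rewrite !inE => Ax Ay /= hxy; apply: finj; apply: hinj => //;
  rewrite inE; [by exists x|by exists y].
Qed.

(** * Standard Borel spaces as complete separable metric spaces *)

Section Epsilon.
Context (R : realType).

Definition eps (n : nat) : R := 2^-1 ^+ n.

Lemma eps_gt0 n : 0 < eps n.
Proof. by rewrite exprn_gt0// invr_gt0. Qed.

Lemma epsS n : eps n = eps n.+1 + eps n.+1.
Proof. by rewrite /eps exprS; lra. Qed.

Lemma eps_le m n : (m <= n)%N -> eps n <= eps m.
Proof.
move=> mn; rewrite -(subnK mn); elim: (n - m)%N => [//|k IH].
by rewrite addSn; have := epsS (k + m); have := eps_gt0 (k + m).+1; lra.
Qed.

Lemma eps_small (e : R) : 0 < e -> exists n, eps n < e.
Proof.
move=> e0; have [N _ /(_ N (leqnn N))] := near_infty_natSinv_expn_lt (PosNum e0).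
by rewrite /= div1r -exprVn => ?; exists N.
Qed.

End Epsilon.

(** The metric is carried over from the Polish space to [X], so that the whole
construction deals with functions from [X] to [X].  The sequence [q] is dense.
Completeness is stated for sequences with a geometric rate of convergence, and
passes the rate on to the limit; every sequence below comes with such a rate. *)
Record polish_dist (R : realType) d (X : measurableType d)
    (dist : X -> X -> R) (q : nat -> X) : Prop := PolishDist {
  dist_sym : forall x y, dist x y = dist y x ;
  dist_triangle : forall y x z, dist x z <= dist x y + dist y z ;
  dist_xx : forall x, dist x x = 0 ;
  dist_eq0 : forall x y, dist x y = 0 -> x = y ;
  dist_dense : forall x n, exists i, dist x (q i) < eps R n ;
  dist_complete : forall (c : R) (u : nat -> X),
    (forall n m, (n <= m)%N -> dist (u n) (u m) <= c * eps R n) ->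
    exists l, forall n, dist (u n) l <= c * eps R n ;
  measurable_ball : forall x r, measurable [set y | dist x y < r] ;
  measurable_ball_ind : forall G : set (set X), sigma_algebra setT G ->
    (forall x r, G [set y | dist x y < r]) -> measurable `<=` G }.

Section MetricPolish.
Context (R : realType) (Y : metricType R).

Lemma metric_complete_seq (c : R) (u : nat -> Y) : complete_metric Y ->
  (forall n m, (n <= m)%N -> mdist (u n) (u m) <= c * eps R n) ->
  exists l, forall n, mdist (u n) l <= c * eps R n.
Proof.
move=> Yc uc; have c0 : 0 <= c.
  have := uc 0 0 isT; rewrite mdistxx => h; have := eps_gt0 R 0.
  by move=> e0; move: h; rewrite pmulr_lge0.
have small (e : R) : 0 < e -> exists n, c * eps R n < e.
  move=> e0; have c1 : 0 < c + 1 by lra.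
  have [n] := eps_small (divr_gt0 e0 c1).
  rewrite ltr_pdivlMr// mulrDr mulr1 mulrC => h; exists n.
  by have := eps_gt0 R n; lra.
have [l ul] : exists y : Y, u @ \oo --> y.
  apply: Yc; apply/cauchy_ballP => e e0.
  have e20 : 0 < e / 2 by lra.
  have [N cN] := small _ e20; near=> a b; rewrite ballEmdist /=.
  suff H p : (N <= p)%N -> mdist (u N) (u p) < e / 2.
    have [[n1 /= n1N <-] [n2 /= n2N <-]] : (u @` [set n | (N <= n)%N]) a /\
       (u @` [set n | (N <= n)%N]) b.
      split; [near: a|near: b].
        by exists N => // n /= Nn; exists n.
      by exists N => // n /= Nn; exists n.
    have := metric_triangle (u n1) (u N) (u n2).
    have := H _ n1N; have := H _ n2N; rewrite (metric_sym (u n1) (u N)); lra.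
  by move=> /uc h; apply: le_lt_trans h cN.
exists l => n; apply/ler_addgt0Pr => e e0.
have : nbhs l (ball l e) by exact: nbhsx_ballx.
move=> /ul [N _ NP]; have := NP (maxn n N) (leq_maxr _ _).
rewrite ballEmdist /= => h1; have := uc n _ (leq_maxl n N).
have := metric_triangle (u n) (u (maxn n N)) l.
by rewrite (metric_sym (u (maxn n N)) l); lra.
Unshelve. all: by end_near. Qed.

Lemma open_mdist_lt (x : Y) r : open [set y | mdist x y < r].
Proof.
rewrite openE => y /= xy; apply/nbhs_ballP; exists (r - mdist x y) => /=.
  by rewrite subr_gt0.
rewrite ballEmdist => z /= yz; have := metric_triangle x y z; lra.
Qed.

End MetricPolish.

(** Separability makes every open set a countable union of balls, so that balls
generate the Borel sets. *)
Lemma standard_borel_polish (R : realType) d (X : measurableType d) :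
  standard_borel R X -> exists (dist : X -> X -> R) (q : nat -> X),
    polish_dist dist q.
Proof.
move=> [Y [f [Yc [D cD dD] [g fK gK] fB]]].
have [e eD] : exists e : nat -> X, f @^-1` D `<=` range e.
  have /pcard_surjP[e eD] : (f @^-1` D #<= [set: nat])%card.
    have [h hinj] := elimT (countable_injP _) cD.
    apply/countable_injP; exists (h \o f) => x y; rewrite !inE => Dx Dy /= hxy.
    by apply: (can_inj fK); apply: hinj => //; rewrite inE.
  by exists e.
have dense_seq x n : exists i, mdist (f x) (f (e i)) < eps R n.
  have [] := dD (ball (f x)  (eps R n))^°.
  + exists (f x); exact: nbhsx_ballx (eps_gt0 _ _).
  + exact: open_interior.
  move=> y [/interior_subset]; rewrite ballEmdist /= => xy Dy.
  have [i _ eiy] : range e (g y) by apply: eD; rewrite /= gK.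
  by exists i; rewrite eiy gK.
exists (fun x y => mdist (f x) (f y)), e; split=> //.
- by move=> x y; rewrite metric_sym.
- by move=> x y z; exact: metric_triangle.
- by move=> x; rewrite mdistxx.
- by move=> x y /mdist_positivity /(can_inj fK).
- move=> c u uc; have [l ul] := metric_complete_seq Yc uc.
  by exists (g l) => n; rewrite gK.
- move=> x r; have : measurable (f @^-1` [set y | mdist (f x) y < r]); last by [].
  apply/fB; apply: sub_sigma_algebra; exact: open_mdist_lt.
- move=> G [G0 GC GU] Gball A mA.
  have GS : sigma_algebra setT [set B : set Y | G (f @^-1` B)].
    split; rewrite /= ?preimage_set0//.
      by move=> B GB; rewrite setTD preimage_setC -setTD; exact: GC.
    by move=> F GF; rewrite preimage_bigcup; exact: GU.
  have <- : f @^-1` (g @^-1` A) = A.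
    by apply/seteqP; split=> x; rewrite /= fK.
  suff : <<s open >> `<=` [set B : set Y | G (f @^-1` B)].
    by apply; apply/fB; rewrite -comp_preimage (_ : g \o f = id) ?preimage_id//;
      apply/funext => x /=; rewrite fK.
  apply: smallest_sub => // U oU /=.
  (* The balls with centre in the dense sequence and radius a power of 1/2 that
     are contained in U. *)
  pose F (k : nat * nat) := if `[< forall y, mdist (f (e k.1)) y < eps R k.2 -> U y >]
     then [set y | mdist (f (e k.1)) (f y) < eps R k.2] else set0.
  rewrite [X in G X](_ : _ = \bigcup_k F k).
    apply: sigma_algebra_bigcupT => // k; rewrite /F; case: ifP => // _; exact: Gball.
  apply/seteqP; split=> [x Ux|x [k _]]; last first.
    by rewrite /F; case: asboolP => // + /=; apply.
  have : nbhs (f x) U by exact: open_nbhs_nbhs.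
  move=> /nbhs_ballP[r /= r0]; rewrite ballEmdist => xU.
  have [n nr] := eps_small r0.
  have [i xi] := dense_seq x n.+1.
  exists (i, n.+1) => //; rewrite /F; case: asboolP => /=; first by rewrite metric_sym.
  case=> y iy; apply: xU => /=; have := metric_triangle (f x) (f (e i)) y.
  by have := epsS R n; lra.
Qed.

(** * Measurable functions into a Polish space *)

Section PolishBorel.
Context (R : realType) d (X : measurableType d) (dist : X -> X -> R) (q : nat -> X).
Context (P : polish_dist dist q).
Local Notation eps := (eps R).

Lemma dist_ge0 x y : 0 <= dist x y.
Proof.
have := dist_triangle P y x x.
by rewrite (dist_sym P y) (dist_xx P); lra.
Qed.

Lemma measurable_fun_ball d' (T : measurableType d') (f : T -> X) :
  (forall x r, measurable [set t | dist x (f t) < r]) -> measurable_fun setT f.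
Proof.
move=> mf _ B mB; rewrite setTI.
have GS : sigma_algebra setT [set B : set X | measurable (f @^-1` B)].
  split; rewrite /= ?preimage_set0//.
    by move=> A GA; rewrite setTD preimage_setC; exact: measurableC.
  by move=> F GF; rewrite preimage_bigcup; exact: bigcupT_measurable.
exact: (measurable_ball_ind P GS).
Qed.

Lemma measurable_ball_comp d' (T : measurableType d') (f : T -> X) x r :
  measurable_fun setT f -> measurable [set t | dist x (f t) < r].
Proof. by move=> mf; exact: (measurable_preimage mf (measurable_ball P x r)). Qed.

(** If [f t] can be computed up to [c * eps n] from a discrete measurable
datum [s n t], then [f t] is in a given open ball if and only if some
approximation certifies it. *)
Lemma measurable_fun_lim d' (T : measurableType d') (J : countType)
    (s : nat -> T -> J) (v : nat -> J -> X) (c : R) (f : T -> X) :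
  (forall n j, measurable [set t | s n t = j]) ->
  (forall n t, dist (v n (s n t)) (f t) <= c * eps n) ->
  measurable_fun setT f.
Proof.
move=> ms sf; apply: measurable_fun_ball => x r.
pose F (k : nat * J) :=
  [set t | s k.1 t = k.2 /\ dist x (v k.1 k.2) + c * eps k.1 < r].
rewrite [X in measurable X](_ : _ = \bigcup_k F k).
  by apply: measurable_bigcupT => -[n j]; apply: measurable_cond; exact: ms.
apply/seteqP; split=> [t /= xt|t [[n j] _ []]] /=; last first.
  by move=> <-; have := sf n t; have := dist_triangle P (v n (s n t)) x (f t); lra.
have c0 : 0 <= c * eps 0.
  by apply: le_trans (sf 0%N t); exact: dist_ge0.
have {}c0 : 0 <= c by move: c0; rewrite (pmulr_lge0 _ (eps_gt0 R 0)).
have e0 : 0 < (r - dist x (f t)) / (2 * (c + 1)) by rewrite divr_gt0//; lra.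
have [n] := eps_small e0; rewrite ltr_pdivlMr ?mulr_gt0//; last by lra.
rewrite mulrCA mulrDr mulr1 (mulrC _ c) => h.
exists (n, s n t) => //; split => //=; have := sf n t.
have := dist_triangle P (f t) x (v n (s n t)).
by rewrite (dist_sym P (f t)); have := eps_gt0 R n; lra.
Qed.

Lemma measurable_closed_ball x r : measurable [set y | dist x y <= r].
Proof.
rewrite [X in measurable X](_ : _ = \bigcap_n [set y | dist x y < r + eps n]).
  by apply: measurable_bigcapT => n; exact: (measurable_ball P).
apply/seteqP; split=> [y /= xy n _|y /= xy]; first by have := eps_gt0 R n; rewrite /=; lra.
rewrite leNgt; apply/negP => h; have /eps_small[n nr] : 0 < dist x y - r by lra.
by have := xy n I; rewrite /=; lra.
Qed.

(** Two distinct points are separated by one of countably many balls. *)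
Lemma measurable_eq_fun d' (T : measurableType d') (f g : T -> X) :
  measurable_fun setT f -> measurable_fun setT g -> measurable [set t | f t = g t].
Proof.
move=> mf mg.
pose F (k : nat * nat) := [set t | dist (q k.1) (f t) < eps k.2] `&`
  ~` [set t | dist (q k.1) (g t) < eps k.2].
rewrite -[X in measurable X]setCK [X in ~` X](_ : _ = \bigcup_k F k).
  apply/measurableC/measurable_bigcupT => k.
  by apply: measurableI; [|apply: measurableC]; exact: measurable_ball_comp.
apply/seteqP; split=> [t /= fg|t [k _ [/= h1 h2]] fg]; last by apply: h2; rewrite -fg.
have : 0 < dist (f t) (g t).
  rewrite lt_neqAle eq_sym; apply/andP; split; first by apply/eqP => /(dist_eq0 P).
  exact: dist_ge0.
move=> /eps_small[n nr]; have [i fi] := dist_dense P (f t) n.+1.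
exists (i, n.+1) => //; split; first by rewrite /= (dist_sym P).
move=> /= gi; have := dist_triangle P (q i) (f t) (g t).
by have := epsS R n; lra.
Qed.

Lemma measurable_point (x : X) : measurable [set x].
Proof.
by apply: (@measurable_eq_fun _ X id (cst x));
  [exact: measurable_id|exact: measurable_cst].
Qed.

Lemma measurable_countable (A : set X) : countable A -> measurable A.
Proof. by apply: countable_measurable => x; exact: measurable_point. Qed.

(** A measurable left inverse replaces the Lusin-Souslin theorem: the range of
[f] is the set of fixed points of [f \o g]. *)
Lemma measurable_left_inverse_image (f g : X -> X) (B : set X) :
  measurable_fun setT f -> measurable_fun setT g -> cancel f g ->
  measurable B -> measurable (f @` B).
Proof.
move=> mf mg fK mB.
rewrite [X in measurable X](_ : _ = [set x | f (g x) = x] `&` g @^-1` B).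
  apply: measurableI; last exact: measurable_preimage.
  by apply: measurable_eq_fun; [exact: measurableT_comp|exact: measurable_id].
apply/seteqP; split=> [_ [x Bx <-]|x [/= h Bx]]; first by rewrite /= fK.
by exists (g x).
Qed.

End PolishBorel.

(** * Borel sets are Suslin *)

Section Suslin.
Context (R : realType) d (X : measurableType d) (dist : X -> X -> R) (q : nat -> X).
Context (P : polish_dist dist q).
Local Notation eps := (eps R).

(** [C] is read as a subset of the product of the Baire space with [X], closed
for the product topology. *)
Definition closed_family (C : (nat -> nat) -> set X) : Prop :=
  forall a x, (forall n, exists b y,
    [/\ C b y, (forall i, (i < n)%N -> b i = a i) & dist x y < eps n]) -> C a x.

Definition suslin (A : set X) : Prop :=
  exists2 C : (nat -> nat) -> set X, closed_family C & A = \bigcup_a C a.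

Lemma suslin_closed (F : set X) :
  (forall x, (forall n, exists2 y, F y & dist x y < eps n) -> F x) -> suslin F.
Proof.
move=> clF; exists (fun=> F); last by rewrite bigcup_const//; exists id.
by move=> a x h; apply: clF => n; have [_ [y [Fy _ xy]]] := h n; exists y.
Qed.

(** The first term of the sequence tells which set of the union is used. *)
Lemma suslin_bigcup (A : nat -> set X) :
  (forall n, suslin (A n)) -> suslin (\bigcup_n A n).
Proof.
move=> sA; have /choice[C CA] : forall n, exists C, closed_family C /\ A n = \bigcup_a C a.
  by move=> n; have [C clC AC] := sA n; exists C.
have clC n := (CA n).1; have AC n := (CA n).2.
exists (fun a => C (a 0%N) (fun i => a i.+1)).
  move=> a x h; apply: clC => n; have [b [y [Cb ba xy]]] := h n.+1.
  exists (fun i => b i.+1), y; split.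
  - by rewrite -ba.
  - by move=> i ?; exact: ba.
  - by have := epsS R n; have := eps_gt0 R n.+1; lra.
apply/seteqP; split=> [x [n _]|x [a _ Cx]]; last first.
  by exists (a 0%N) => //; rewrite AC; exists (fun i => a i.+1).
by rewrite AC => -[a _ Cx]; exists (fun i => if i is j.+1 then a j else n).
Qed.

(** One sequence encodes countably many of them, one for each set of the
intersection; finitely many terms of each depend on finitely many terms. *)
Lemma suslin_bigcap (A : nat -> set X) :
  (forall n, suslin (A n)) -> suslin (\bigcap_n A n).
Proof.
move=> sA; have /choice[C CA] : forall n, exists C, closed_family C /\ A n = \bigcup_a C a.
  by move=> n; have [C clC AC] := sA n; exists C.
have clC n := (CA n).1; have AC n := (CA n).2.
exists (fun a x => forall k, C k (fun j => a (pickle (k, j))) x).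
  move=> a x h k; apply: clC => n.
  have [N nN hN] : exists2 N, (n <= N)%N & forall j, (j < n)%N -> (pickle (k, j) < N)%N.
    exists (maxn n (\max_(j < n) (pickle (k, val j)).+1)); first exact: leq_maxl.
    move=> j jn; rewrite leq_max; apply/orP; right.
    exact: (leq_bigmax (Ordinal jn)).
  have [b [y [Cb ba xy]]] := h N; exists (fun j => b (pickle (k, j))), y; split=> //.
    by move=> j /hN; exact: ba.
  exact: lt_le_trans xy (eps_le _ nN).
apply/seteqP; split=> [x Ax|x [a _ Cx] k _]; last first.
  by rewrite AC; exists (fun j => a (pickle (k, j))).
have /choice[a Ca] : forall k, exists a, C k a x.
  by move=> k; have := Ax k I; rewrite AC => -[a _ ?]; exists a.
exists (fun n => if unpickle n is Some (k, j) then a k j else 0%N) => // k.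
by rewrite (_ : (fun j => _) = a k)//; apply/funext => j; rewrite pickleK.
Qed.

(** The sets that are Suslin together with their complement form a
sigma-algebra. *)
Lemma measurable_suslin (A : set X) : measurable A -> suslin A.
Proof.
move=> mA; suff [] : suslin A /\ suslin (~` A) by [].
have suslin0 : suslin set0 by apply: suslin_closed => x /(_ 0%N)[].
have suslinT : suslin setT by apply: suslin_closed.
apply: (measurable_ball_ind (G := [set A | suslin A /\ suslin (~` A)]) P _ _ mA)
    => {A mA}.
  split=> /= [|A [sA sCA]|F sF].
  - by split=> //; rewrite setC0.
  - by rewrite setTD setCK.
  - split; first by apply: suslin_bigcup => n; case: (sF n).
    by rewrite setC_bigcup; apply: suslin_bigcap => n; case: (sF n).
move=> x r; split.
  rewrite (_ : [set y | _] = \bigcup_n [set y | dist x y <= r - eps n]).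
    apply: suslin_bigcup => n; apply: suslin_closed => y h /=.
    rewrite leNgt; apply/negP => yr.
    have /eps_small[k kr] : 0 < dist x y - (r - eps n) by lra.
    have [z /= xz yz] := h k; have := dist_triangle P z x y.
    by rewrite (dist_sym P z); lra.
  apply/seteqP; split=> [y /= xy|y [n _] /=]; last by have := eps_gt0 R n; lra.
  have /eps_small[n nr] : 0 < r - dist x y by lra.
  by exists n => //=; lra.
apply: suslin_closed => y h /= yr; have /eps_small[k kr] : 0 < r - dist x y by lra.
have [z /= xz yz] := h k; have := dist_triangle P y x z; lra.
Qed.

End Suslin.

(** * Perfect sets in uncountable Borel sets *)

Section Splitting.
Context (R : realType) d (X : measurableType d) (dist : X -> X -> R) (q : nat -> X).
Context (P : polish_dist dist q).
Local Notation eps := (eps R).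

(** Removing from [E] the countably many basic balls that meet it in a countable
set leaves an uncountable set; two distinct points that remain have small
disjoint neighbourhoods, each of which meets [E] in an uncountable set. *)
Lemma uncountable_split (E : set X) n : ~ countable E ->
  exists c0 c1 m, [/\ (n <= m)%N, eps m + eps m < dist c0 c1,
    ~ countable (E `&` [set y | dist c0 y < eps m]) &
    ~ countable (E `&` [set y | dist c1 y < eps m])].
Proof.
move=> nE.
pose B (k : nat * nat) := E `&` [set y | dist (q k.1) y < eps k.2].
pose S := \bigcup_(k in [set k | countable (B k)]) B k.
have cS : countable S by exact: bigcup_countable.
have nES : ~ countable (E `\` S).
  have [|[]//] := @uncountable_bigcup _ bool (fun b => if b then E `\` S else S) E _ nE.
  by move=> x Ex; have [|] := pselect (S x); [exists false|exists true].
(* The points x0 and x1 are condensation points of E. *)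
have [x0 x0ES] : E `\` S !=set0.
  by apply/set0P/negP => /eqP h; apply: nES; rewrite h.
have [x1 x1ES x01] : exists2 x1, (E `\` S) x1 & x1 <> x0.
  apply: contrapT => /forall2NP h; apply: nES; apply: (@sub_countable _ _ _ [set x0]) => //.
  apply: subset_card_le => x xES; have [/(_ xES)//|] := h x.
  exact: contrapT.
have big x m : (E `\` S) x -> exists2 c, dist x c < eps m &
    ~ countable (E `&` [set y | dist c y < eps m]).
  move=> [Ex nSx]; have [i xi] := dist_dense P x m; exists (q i) => // ci.
  by apply: nSx; exists (i, m) => //; split=> //=; rewrite (dist_sym P).
have : 0 < dist x0 x1.
  rewrite lt_neqAle eq_sym (dist_ge0 P) andbT; apply/eqP => /(dist_eq0 P) h.
  by apply: x01.
move=> /eps_small[k kr].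
pose m := maxn n k.+2.
have mk : eps m <= eps k.+2 by apply: eps_le; exact: leq_maxr.
have [c0 xc0 n0] := big _ m x0ES; have [c1 xc1 n1] := big _ m x1ES.
exists c0, c1, m; split=> //; first exact: leq_maxl.
have := dist_triangle P c0 x0 x1; have := dist_triangle P c1 c0 x1.
have := epsS R k; have := epsS R k.+1; rewrite (dist_sym P c1 x1); lra.
Qed.

End Splitting.

(** Prefixes are reversed so that extending a branch of the binary tree is a
[cons], and a recursion on the list goes down the tree. *)
Fixpoint rprefix (z : nat -> bool) (n : nat) : seq bool :=
  if n is k.+1 then z k :: rprefix z k else [::].

Lemma size_rprefix z n : size (rprefix z n) = n.
Proof. by elim: n => //= n ->. Qed.

Section CantorScheme.
Context (R : realType) d (X : measurableType d) (dist : X -> X -> R) (q : nat -> X).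
Context (P : polish_dist dist q).
Local Notation eps := (eps R).
Local Notation family := ((nat -> nat) -> set X).

(** Besides separating two uncountable parts in [X], the next coordinate of the
Baire space is made constant on each part, by the pigeonhole principle for
countably many classes. *)
Lemma split_family (D : family) n : ~ countable (\bigcup_a D a) ->
  exists (m : nat) (r : bool -> family * nat * X),
  [/\ (n < m)%N, eps m + eps m < dist (r false).2 (r true).2 &
    forall b, ~ countable (\bigcup_a (r b).1.1 a) /\
      forall a x, (r b).1.1 a x ->
        [/\ D a x, a n = (r b).1.2 & dist (r b).2 x < eps m] ].
Proof.
move=> /(uncountable_split P n.+1)[c0 [c1 [m [nm c01 u0 u1]]]].
have sub c : ~ countable (\bigcup_a D a `&` [set y | dist c y < eps m]) ->
    exists k, ~ countable (\bigcup_a [set x | [/\ D a x, a n = k & dist c x < eps m] ]).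
  apply: uncountable_bigcup => x [[a _ Dx] /= cx].
  by exists (a n) => //; exists a.
have [k0 v0] := sub _ u0; have [k1 v1] := sub _ u1.
pose r (c : X) (k : nat) : family * nat * X :=
  (fun a => [set x | [/\ D a x, a n = k & dist c x < eps m] ], k, c).
by exists m, (fun b => if b then r c1 k1 else r c0 k0); split=> // -[].
Qed.

Lemma cantor_scheme (C : family) : ~ countable (\bigcup_a C a) ->
  exists (D : seq bool -> family) (k : seq bool -> nat) (c : seq bool -> X)
         (m : seq bool -> nat),
  [/\ D [::] = C, forall s, (size s < m s)%N,
    forall s, eps (m s) + eps (m s) < dist (c (false :: s)) (c (true :: s)) &
    forall s, ~ countable (\bigcup_a D s a) /\
      forall b a x, D (b :: s) a x ->
        [/\ D s a x, a (size s) = k (b :: s) & dist (c (b :: s)) x < eps (m s)] ].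
Proof.
move=> bigC.
have /choice[step stepP] : forall nD : nat * family,
    exists mr : nat * (bool -> family * nat * X),
    ~ countable (\bigcup_a nD.2 a) ->
    [/\ (nD.1 < mr.1)%N, eps mr.1 + eps mr.1 < dist (mr.2 false).2 (mr.2 true).2 &
    forall b, ~ countable (\bigcup_a (mr.2 b).1.1 a) /\
      forall a x, (mr.2 b).1.1 a x ->
        [/\ nD.2 a x, a nD.1 = (mr.2 b).1.2 & dist (mr.2 b).2 x < eps mr.1] ].
  move=> [n D] /=; have [cD|nD] := pselect (countable (\bigcup_a D a)).
    by exists (0%N, fun=> (D, 0%N, point)) => /(_ cD).
  by have [m [r rP]] := split_family n nD; exists (m, r).
pose D := fix D s := if s is b :: t then ((step (size t, D t)).2 b).1.1 else C.
have bigD s : ~ countable (\bigcup_a D s a).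
  by elim: s => [//|b s /(stepP (size s, D s))[_ _ /(_ b)[]]].
exists D, (fun s => if s is b :: t then ((step (size t, D t)).2 b).1.2 else 0%N),
  (fun s => if s is b :: t then ((step (size t, D t)).2 b).2 else point),
  (fun s => (step (size s, D s)).1).
split=> // s; have [sm sd sD] := stepP (size s, D s) (bigD s) => //.
by split=> // b a x; case: (sD b) => _; apply.
Qed.

(** Along a branch [z] of the scheme both the coordinates in the Baire space and
the points of [X] converge, and the limit stays in the closed set [C]; its
projection is [h z].  The sets [V n] are built from the closed balls of the
scheme: they read the digits of [z] off [h z], in a way that is measurable on
the whole of [X].  The functions [v] witness that [h] is uniformly
continuous. *)
Lemma cantor_embedding (A : set X) : suslin dist A -> ~ countable A ->
  exists (h : (nat -> bool) -> X) (v : seq bool -> X) (V : nat -> set X),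
  [/\ forall z, A (h z), forall n, measurable (V n),
    forall z n, V n (h z) <-> z n &
    forall z n, dist (v (rprefix z n.+1)) (h z) <= eps n].
Proof.
move=> [C clC ->] /cantor_scheme[D [k [c [m [D0 ms cc]]]]].
move=> /all_and2[bigD nestD].
(* The constraints accumulated on the way down to level n. *)
have branch z n a x : D (rprefix z n) a x -> C a x /\ forall i, (i < n)%N ->
    a i = k (rprefix z i.+1) /\
    dist (c (rprefix z i.+1)) x < eps (m (rprefix z i)).
  elim: n => [|n IH] /=; first by rewrite D0.
  move=> /nestD[/IH[Cax IHn] an cx]; split=> // i; rewrite ltnS leq_eqVlt.
  by move=> /predU1P[->|/IHn//]; rewrite size_rprefix in an.
have /choice[w wP] : forall zn : (nat -> bool) * nat, exists w : (nat -> nat) * X,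
    D (rprefix zn.1 zn.2) w.1 w.2.
  move=> [z n] /=; apply: contrapT => /forallNP h; apply: (bigD (rprefix z n)).
  rewrite [X in countable X](_ : _ = set0)//; apply/seteqP; split=> // x [a _ Dx].
  exact: (h (a, x)).
pose u z n := (w (z, n.+1)).2.
have cu z n p : (n <= p)%N -> dist (c (rprefix z n.+1)) (u z p) < eps (m (rprefix z n)).
  by move=> np; have [_ /(_ n)[]] := branch _ _ _ _ (wP (z, p.+1)).
have em z n : eps (m (rprefix z n)) <= eps n.+1.
  by apply: eps_le; have := ms (rprefix z n); rewrite size_rprefix.
have /choice[h hP] : forall z, exists l, forall n, dist (u z n) l <= eps n.
  move=> z; have [|l hl] := dist_complete P (c := 1) (u := u z).
    move=> n p np; rewrite mul1r.
    have := dist_triangle P (c (rprefix z n.+1)) (u z n) (u z p).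
    have := cu z n n (leqnn n); have := cu z n p np; have := em z n; have := epsS R n.
    by rewrite (dist_sym P (u z n) (c _)); lra.
  by exists l => n; rewrite -[eps n]mul1r.
have ch z n : dist (c (rprefix z n.+1)) (h z) <= eps (m (rprefix z n)).
  rewrite leNgt; apply/negP => lt.
  have /eps_small[p pr] : 0 < dist (c (rprefix z n.+1)) (h z) - eps (m (rprefix z n)).
    by rewrite subr_gt0.
  have := cu z n (maxn n p) (leq_maxl _ _); have := hP z (maxn n p).
  have := eps_le R (leq_maxr n p).
  have := dist_triangle P (u z (maxn n p)) (c (rprefix z n.+1)) (h z); lra.
(* The balls of the scheme need not be nested; intersecting along branches makes
   the sets of one level disjoint. *)
pose K := fix K s := if s is b :: t
  then K t `&` [set x | dist (c (b :: t)) x <= eps (m t)] else [set: X].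
have mK s : measurable (K s).
  elim: s => [|b s IH]; first exact: measurableT.
  by apply: measurableI => //; exact: (measurable_closed_ball P).
have Kinj s t x : size s = size t -> K s x -> K t x -> s = t.
  elim: s t => [|b s IH] [|b' t]//= [st] [Ks bx] [Kt bx'].
  have ? := IH t st Ks Kt; subst t; suff -> : b = b' by [].
  have := cc s; have := dist_triangle P x (c (false :: s)) (c (true :: s)).
  by rewrite (dist_sym P x); case: b b' bx bx' => -[]//; lra.
have Kh z n : K (rprefix z n) (h z) by elim: n => [//|n IH]; split=> //=; exact: ch.
exists h, c, (fun n => \bigcup_s [set x | K (true :: s) x /\ size s = n]); split.
- move=> z; exists (fun i => k (rprefix z i.+1)) => //; apply: clC => n.
  have [Cw wn] := branch _ _ _ _ (wP (z, n.+2)).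
  exists (w (z, n.+2)).1, (u z n.+1); split=> //.
    by move=> i lin; have [] := wn i (leq_trans lin (leq_addl 2 n)).
  rewrite (dist_sym P); have := hP z n.+1; have := epsS R n.
  by have := eps_gt0 R n.+1; lra.
- move=> n; apply: measurable_bigcupT => s; exact: measurable_cond.
- move=> z n; split=> [[s _ [Ks sn]]|zn].
    have : true :: s = rprefix z n.+1.
      by apply: Kinj Ks (Kh z n.+1); rewrite size_rprefix /= sn.
    by case=> <-.
  exists (rprefix z n) => //; split; last exact: size_rprefix.
  by have := Kh z n.+1; rewrite /= zn.
- by move=> z n; have := ch z n; have := em z n; have := epsS R n;
    have := eps_gt0 R n.+1; lra.
Qed.

End CantorScheme.

(** * Coding points by binary sequences *)

(** The default value [0] makes the search total, as decoding has to be defined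
on all binary sequences. *)
Definition first_index (b : nat -> bool) : nat :=
  if pselect (exists i, b i) is left e then ex_minn e else 0.

Lemma first_indexP (b : nat -> bool) : (exists i, b i) -> b (first_index b).
Proof. by rewrite /first_index; case: pselect => // e _; case: ex_minnP. Qed.

Lemma measurable_first_index d (T : measurableType d) (b : T -> nat -> bool) i :
  (forall n, measurable [set t | b t n]) ->
  measurable [set t | first_index (b t) = i].
Proof.
move=> mb; rewrite [X in measurable X](_ : _ =
  ([set t | b t i] `&` \bigcap_j [set t | ~ b t j \/ (i <= j)%N]) `|`
  [set t | (\bigcap_j ~` [set t | b t j]) t /\ i = 0%N]).
  apply: measurableU.
    apply: measurableI => //; apply: measurable_bigcapT => j.
    have [ij|ij] := leqP i j.
      by rewrite (_ : [set t | _] = setT)//; apply/seteqP; split=> // t _; right.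
    rewrite (_ : [set t | _] = ~` [set t | b t j]); first exact: measurableC.
    by apply/seteqP; split=> t /=; [case|left].
  by apply: measurable_cond; apply: measurable_bigcapT => j; exact: measurableC.
apply/seteqP; split=> [t /= <-|t [[/= bi mi]|[/= nb ->]]]; rewrite /first_index;
  case: pselect => [e|ne].
- case: ex_minnP => m bm mm; left; split=> // j _ /=.
  by have [/mm|] := boolP (b t j); [right|left].
- by right; split=> // j _ /= bj; apply: ne; exists j.
- case: ex_minnP => m bm mm; apply/eqP; rewrite eqn_leq mm//=.
  by have [] := mi m I.
- by exfalso; apply: ne; exists i.
- by case: (e) => k bk; case: (nb k I).
- by [].
Qed.

Section Coding.
Context (R : realType) d (X : measurableType d) (dist : X -> X -> R) (q : nat -> X).
Context (P : polish_dist dist q).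
Local Notation eps := (eps R).

(** The code of [x] records which balls of radius [eps n] and centre [q i]
contain [x].  To decode, take for each [n] the first centre whose ball is
recorded. *)
Lemma cantor_coding : exists (U : nat -> set X) (psi : (nat -> bool) -> X),
  [/\ forall n, measurable (U n),
    forall x, psi (fun n => `[< U n x >]) = x &
    forall u : X -> nat -> bool, (forall n, measurable [set x | u x n]) ->
      measurable_fun setT (psi \o u)].
Proof.
pose U k := if unpickle k is Some (i, n) then [set x | dist (q i) x < eps n] else set0.
pose ix (z : nat -> bool) (n : nat) := first_index (fun i => z (pickle (i, n))).
(* A centre that is too far from the previous one is rejected: so the sequence of
   centres converges even for the sequences that code no point. *)
pose jx z := fix jx n := if n is k.+1 then
    (if dist (q (jx k)) (q (ix z n)) <= eps k + eps k then ix z n else jx k)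
  else ix z 0%N.
have jxS z n : dist (q (jx z n)) (q (jx z n.+1)) <= eps n + eps n.
  by rewrite /=; case: ifP => // _; rewrite (dist_xx P); have := eps_gt0 R n; lra.
have jx_cauchy z n p : (n <= p)%N ->
    dist (q (jx z n)) (q (jx z p)) <= 4 * eps n - 4 * eps p.
  move=> np; rewrite -(subnK np); elim: (p - n)%N => [|k IH].
    by rewrite (dist_xx P); lra.
  have := jxS z (k + n)%N; have := epsS R (k + n)%N; rewrite addSn.
  by have := dist_triangle P (q (jx z (k + n)%N)) (q (jx z n)) (q (jx z (k + n).+1)); lra.
have /choice[psi psiP] : forall z, exists l, forall n, dist (q (jx z n)) l <= 4 * eps n.
  move=> z; apply: (dist_complete P (u := fun n => q (jx z n))) => n p np.
  by have := jx_cauchy z n p np; have := eps_gt0 R p; lra.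
exists U, psi; split.
- move=> n; rewrite /U; case: unpickle => [[i k]|]; last exact: measurable0.
  exact: (measurable_ball P).
- move=> x; set z := fun n => _.
  have ixP n : dist (q (ix z n)) x < eps n.
    have -> : (dist (q (ix z n)) x < eps n) = z (pickle (ix z n, n)).
      by rewrite /z /U pickleK; apply/idP/asboolP.
    apply: (@first_indexP (fun i => z (pickle (i, n)))).
    have [i xi] := dist_dense P x n; exists i.
    by rewrite /z /U pickleK; apply/asboolP; rewrite /= (dist_sym P).
  have jxE n : jx z n = ix z n.
    elim: n => //= n ->; case: ifP => // /negP[].
    have := dist_triangle P x (q (ix z n)) (q (ix z n.+1)).
    have := ixP n; have := ixP n.+1; rewrite (dist_sym P x).
    by have := epsS R n; have := eps_gt0 R n.+1; lra.
  apply: (dist_eq0 P); apply/eqP; rewrite eq_le (dist_ge0 P) andbT.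
  rewrite leNgt; apply/negP => lt.
  have /eps_small[n nlt] : 0 < dist (psi z) x / 5 by lra.
  have := psiP z n; rewrite jxE; have := ixP n.
  have := dist_triangle P (q (ix z n)) (psi z) x.
  by rewrite (dist_sym P (psi z) (q _)); lra.
- move=> u mu.
  apply: (measurable_fun_lim P (s := fun n x => jx (u x) n) (v := fun _ j => q j)
    (c := 4)) => [n j|n x]; last exact: psiP.
  have mix k i : measurable [set x | ix (u x) k = i].
    by apply: measurable_first_index => p.
  elim: n j => [j|n IH j]; first exact: mix.
  pose F (k : nat * nat) := [set x | ([set x | jx (u x) n = k.1] `&`
      [set x | ix (u x) n.+1 = k.2]) x /\
    (if dist (q k.1) (q k.2) <= eps n + eps n then k.2 else k.1) = j].
  rewrite [X in measurable X](_ : _ = \bigcup_k F k).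
    by apply: measurable_bigcupT => k; apply: measurable_cond; exact: measurableI.
  apply/seteqP; split=> [x /= xj|x [[a b] _ [[/= <- <-]]]] //.
  by exists (jx (u x) n, ix (u x) n.+1).
Qed.

(** A point is coded by a binary sequence, which is sent into [A] by a Cantor
embedding; both steps can be undone measurably. *)
Lemma borel_embedding (A : set X) : measurable A -> ~ countable A ->
  exists f g : X -> X, [/\ measurable_fun setT f, measurable_fun setT g,
    cancel f g & forall x, A (f x)].
Proof.
move=> /(measurable_suslin P) sA /(cantor_embedding P sA)[h [v [V [hA mV hV vh]]]].
have [U [psi [mU psiU mpsi]]] := cantor_coding.
exists (fun x => h (fun n => `[< U n x >])), (psi \o fun x n => `[< V n x >]); split=> //.
- apply: (measurable_fun_lim P (v := fun=> v) (c := 1)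
      (s := fun n x => rprefix (fun k => `[< U k x >]) n.+1)); last first.
    by move=> n x; rewrite mul1r; exact: vh.
  move=> n s; move: n.+1 => {}n; elim: n s => [|n IH] s /=.
    rewrite (_ : [set x | _] = [set x | setT x /\ [::] = s]).
      by apply: measurable_cond; exact: measurableT.
    by apply/seteqP; split=> x //= [].
  case: s => [|b s].
    by rewrite (_ : [set x | _] = set0)//; apply/seteqP; split.
  rewrite (_ : [set x | _] = (if b then U n else ~` U n) `&`
     [set x | rprefix (fun k => `[< U k x >]) n = s]).
    by apply: measurableI => //; case: b; [|apply: measurableC].
  apply/seteqP; split=> x /=.
    by move=> [<- <-]; split=> //; case: asboolP.
  by move=> [+ <-]; case: b => Ux; congr (_ :: _); [apply/asboolP|apply/asboolPn].
- apply: mpsi => n; rewrite (_ : [set x | _] = V n)//.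
  by apply/seteqP; split=> x /asboolP.
- move=> x /=; rewrite -[RHS]psiU; congr psi; apply/funext => n.
  by apply/asboolP/asboolP => [/hV/asboolP|/asboolP ?]; last exact/hV.
Qed.

End Coding.

(** * Uncountable Borel sets are isomorphic to the whole space *)

Section BorelIsomorphism.
Context (R : realType) d (X : measurableType d) (dist : X -> X -> R) (q : nat -> X).
Context (P : polish_dist dist q).

(** Schroeder-Bernstein, for an injection [f] into [A] and the inclusion of [A]:
apply [f] on the forward orbit [E] of the complement of [A], and the identity
elsewhere. *)
Lemma borel_isomorphism (A : set X) : measurable A -> ~ countable A ->
  exists f g : X -> X, [/\ measurable_fun setT f, measurable_fun setT g,
    cancel f g, forall x, A (f x) & forall a, A a -> f (g a) = a].
Proof.
move=> mA nA; have [f [g [mf mg fK fA]]] := borel_embedding P mA nA.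
pose D n := iter n (fun B => f @` B) (~` A).
have mD n : measurable (D n).
  elim: n => [|n IH]; first exact: measurableC.
  exact: (measurable_left_inverse_image P mf mg fK).
pose E := \bigcup_n D n.
have mE b : measurable [set x | `[< E x >] = b].
  have -> : [set x | `[< E x >] = b] = if b then E else ~` E.
    by apply/seteqP; case: b; split=> x /=; case: asboolP.
  have mE : measurable E by exact: bigcupT_measurable.
  by case: b; [|exact: measurableC].
have Ef x : E x -> E (f x) by move=> [n _ Dx]; exists n.+1 => //; exists x.
exists (fun x => if `[< E x >] then f x else x), (fun x => if `[< E x >] then g x else x).
split.
- apply: (measurable_fun_glue (F := fun b x => if b then f x else x)) => // -[];
    [by []|exact: measurable_id].
- apply: (measurable_fun_glue (F := fun b x => if b then g x else x)) => // -[];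
    [by []|exact: measurable_id].
- move=> x /=; have [Ex|nEx] := asboolP (E x).
    by case: asboolP => [_|/(_ (Ef _ Ex))//]; rewrite fK.
  by case: asboolP.
- move=> x; case: asboolP => // nEx; apply: contrapT => nAx.
  by apply: nEx; exists 0%N.
- move=> a Aa; have [[n _ Dna]|nEa] := asboolP (E a); last by case: asboolP.
  case: n Dna => [//|n [b Db <-]]; rewrite fK; case: asboolP => // -[].
  by exists n.
Qed.

(** An injection of [X] into a ball [B1] disjoint from [B0] moves [B0] to infinitely
many pairwise disjoint copies. *)
Lemma uncountable_pieces (A : set X) : measurable A -> ~ countable A ->
  exists Q : nat -> set X, [/\ forall n, measurable (Q n),
    forall n, ~ countable (Q n), forall n, Q n `<=` A &
    forall i j x, Q i x -> Q j x -> i = j].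
Proof.
move=> mA nA; have [F [G [mF mG FK FA _]]] := borel_isomorphism mA nA.
have nX : ~ countable [set: X].
  by move=> cX; apply: nA; apply: sub_countable cX; exact: subset_card_le.
have [c0 [c1 [m [_ c01]]]] := uncountable_split P 0 nX; rewrite !setTI => nB0 nB1.
have [f [g [mf mg fK fB1]]] := borel_embedding P (measurable_ball P c1 _) nB1.
pose S n := iter n (fun B => f @` B) [set y | dist c0 y < eps R m].
have mS n : measurable (S n).
  elim: n => [|n IH]; first exact: (measurable_ball P).
  exact: (measurable_left_inverse_image P mf mg fK).
have nS n : ~ countable (S n).
  by elim: n => // n IH /(countable_inj_image (can_inj fK)).
have S0 x : S 0%N (f x) -> False.
  rewrite /S /= => h; have := fB1 x; have := dist_triangle P (f x) c0 c1.
  by rewrite (dist_sym P (f x)) /=; lra.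
have Sinj i j x : S i x -> S j x -> i = j.
  elim: i j x => [|i IH] [|j] x //.
  - by move=> S0x [y _ yx]; move: S0x; rewrite -yx => /S0.
  - by move=> [y _ yx]; rewrite -yx => /S0.
  - by move=> [y Sy <-] [z Sz /(can_inj fK) zy]; rewrite (IH j y) // -zy.
exists (fun n => F @` S n); split.
- by move=> n; exact: (measurable_left_inverse_image P mF mG FK).
- by move=> n /(countable_inj_image (can_inj FK)); exact: nS.
- by move=> n _ [x _ <-].
- by move=> i j x [y Sy <-] [z Sz /(can_inj FK) zy]; apply: Sinj Sy _; rewrite -zy.
Qed.

(** The index [k0] receives the part of [A] that the disjoint pieces leave. *)
Lemma uncountable_partition (A : set X) (I : countType) (K : set I) (k0 : I) :
  measurable A -> ~ countable A -> K k0 ->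
  exists k : X -> I, (forall x, K (k x)) /\
    forall i, K i -> measurable (A `&` [set x | k x = i]) /\
      ~ countable (A `&` [set x | k x = i]).
Proof.
move=> mA nA Kk0; have [Q [mQ nQ QA Qinj]] := uncountable_pieces mA nA.
have /choice[k kP] : forall x, exists i, (K i /\ Q (pickle i) x) \/
    (i = k0 /\ forall j, K j -> ~ Q (pickle j) x).
  move=> x; have [[i ?]|h] := pselect (exists i, K i /\ Q (pickle i) x).
    by exists i; left.
  by exists k0; right; split=> // j Kj Qx; apply: h; exists j.
have Qk i x : K i -> Q (pickle i) x -> k x = i.
  move=> Ki Qx; case: (kP x) => [[_ Qk]|[_ /(_ i Ki)//]].
  by apply: (pcan_inj (@pickleK I)); exact: Qinj Qk Qx.
exists k; split=> [x|i Ki]; first by case: (kP x) => [[]|[->]].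
split; last first.
  move=> cA; apply: (nQ (pickle i)); apply: sub_countable cA.
  by apply: subset_card_le => x Qx; split; [exact: QA Qx|exact: Qk].
rewrite (_ : _ `&` _ = Q (pickle i) `|`
    [set x | (A `&` \bigcap_j [set x | ~ (Q (pickle j) x /\ K j)]) x /\ i = k0]).
  apply: measurableU => //; apply: measurable_cond; apply: measurableI => //.
  apply: measurable_bigcapT => j.
  rewrite (_ : [set x | _] = ~` [set x | Q (pickle j) x /\ K j])//.
  by apply: measurableC; exact: measurable_cond.
apply/seteqP; split=> [x [Ax /= kx]|x [Qx|[[Ax /= h] ik]]].
- case: (kP x) => [[_]|[ki nQx]]; first by rewrite kx; left.
  right; split; last by rewrite -kx.
  by split=> // j _ [Qx Kj]; exact: nQx Qx.
- by split; [exact: QA Qx|exact: Qk].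
- split=> //=; case: (kP x) => [[Kk Qkx]|[-> //]].
  by case: (h (k x) (Logic.I)).
Qed.

End BorelIsomorphism.

(** * Orbits of Borel automorphisms *)

Section Orbits.
Context d (X : measurableType d).
Implicit Type T : borel_aut X.

Lemma aut_expzS T (n : int) x : aut_expz T (n + 1) x = T (aut_expz T n x).
Proof.
case: n => [m|[|m]].
- by rewrite -PoszD addn1 /= expgS.
- by rewrite /= expg1; exact/esym/(@aut_invK _ _ T).
- rewrite (_ : Negz m.+1 + 1 = Negz m);
    last by rewrite !NegzE -[m.+2]addn1 PoszD opprD addrK.
  change (aut_inv (T ^+ m.+1)%g x = T (aut_inv (T ^+ m.+2)%g x)).
  by rewrite [(T ^+ m.+2)%g]expgSr; exact/esym/(@aut_invK _ _ T).
Qed.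

(** A sequence indexed by the integers that satisfies the recurrence of an orbit
is the orbit of its term of index [0]. *)
Lemma aut_expz_seq T (u : int -> X) :
  (forall n, u (n + 1) = T (u n)) -> forall n, aut_expz T n (u 0) = u n.
Proof.
move=> uS; elim/int_rect => [//|n IH|n IH].
  by rewrite -addn1 PoszD aut_expzS IH -uS.
apply: (can_inj (@aut_funK _ _ T)); rewrite -aut_expzS -uS.
by rewrite -addn1 PoszD opprD addrNK.
Qed.

Lemma aut_expzD T (m n : int) x :
  aut_expz T (m + n) x = aut_expz T m (aut_expz T n x).
Proof.
rewrite -[n in RHS]add0r.
rewrite (@aut_expz_seq T (fun k => aut_expz T (k + n) x))// => k.
by rewrite addrAC aut_expzS.
Qed.

Lemma aut_orbit_expz T (n : int) x : aut_orbit T (aut_expz T n x) = aut_orbit T x.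
Proof.
apply/seteqP; split=> [_ [m _ <-]|_ [m _ <-]].
  by exists (m + n); rewrite ?aut_expzD.
by exists (m - n) => //; rewrite -aut_expzD subrK.
Qed.

Lemma countable_saturation T (N : set X) : countable N ->
  countable (\bigcup_(n : int) (aut_expz T n @^-1` N)).
Proof.
move=> cN; apply: bigcup_countable => // n _.
apply: (countable_inj_image (f := aut_expz T n)).
  exact: (can_inj (@aut_funK _ _ _)).
by apply: sub_countable cN; apply: subset_card_le => _ [x Nx <-].
Qed.

End Orbits.

(** * Smooth automorphisms with prescribed colours *)

Section SmoothModification.
Context (R : realType) d (X : measurableType d) (dist : X -> X -> R) (q : nat -> X).
Context (P : polish_dist dist q).

(** The automorphism [S] permutes, as a shift, uncountable pieces that are
coloured like the [T]-orbits of chosen points; see the beginning of the file. *)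
Lemma smooth_modification (T : borel_aut X) (L : countType) (a : X -> L) :
  (forall l, measurable [set x | a x = l]) ->
  exists S : borel_aut X, [/\ smooth X S,
    forall x, a (aut_inv T (S x)) = a x & aperiodic X T -> aperiodic X S].
Proof.
move=> ma; pose E : countType := (L * L)%type.
pose col x : E := (a x, a (aut_inv T x)).
have mcol e : measurable [set x | col x = e].
  rewrite (_ : [set x | _] = [set x | a x = e.1] `&`
      aut_inv T @^-1` [set x | a x = e.2]).
    apply: measurableI => //.
    exact: (measurable_preimage (measurable_aut_inv T) (ma e.2)).
  by case: e => e1 e2; apply/seteqP; split=> x /= [<- <-].
(* M is the saturation of the set of points with a rare colour. *)
pose N := \bigcup_(e in [set e | countable [set x | col x = e]]) [set x | col x = e].
have cN : countable N by exact: bigcup_countable.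
pose M := \bigcup_(n : int) (aut_expz T n @^-1` N).
have cM : countable M := countable_saturation T cN.
have MT n x : M (aut_expz T n x) <-> M x.
  split=> -[m _ Nm]; first by exists (m + n) => //=; rewrite aut_expzD.
  by exists (m - n) => //=; rewrite -aut_expzD subrK.
pose W := ~` M.
have mW : measurable W by apply: measurableC; exact: (measurable_countable P).
have WT n x : W x -> W (aut_expz T n x) by move=> Wx /MT.
pose good e := exists2 x, W x & col x = e.
have nW e : good e -> ~ countable (W `&` [set x | col x = e]).
  move=> [x Wx xe] cWe.
  have [ce|] := pselect (countable [set x | col x = e]).
    by apply: Wx; exists 0 => //; exists e.
  pose F (b : bool) := if b then W `&` [set x | col x = e] else M.
  case/(@uncountable_bigcup _ _ F) => [y ye|[]//].
  by have [My|] := pselect (M y); [exists false|exists true].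
(* The T-orbit of r e is the pattern of colours whose term of index 0 is e, and
   lab (e, n) is its term of index n. *)
have /choice[r rP] : forall e, exists x, good e -> W x /\ col x = e.
  by move=> e; have [[x Wx xe]|] := pselect (good e); [exists x|exists point].
pose J : countType := (E * int)%type.
pose lab (k : J) := col (aut_expz T k.2 (r k.1)).
have good_lab (k : J) : good k.1 -> good (lab k).
  by move=> /rP[Wr _]; exists (aut_expz T k.2 (r k.1)) => //; exact: WT.
(* The set of colour e is split among the places k where a pattern has colour
   e; (e, 0) is one of them. *)
pose K e := [set k : J | good k.1 /\ lab k = e].
have /choice[ke keP] : forall e, exists k : X -> J, good e ->
    (forall x, K e (k x)) /\ forall i, K e i ->
      measurable (W `&` [set x | col x = e] `&` [set x | k x = i]) /\
      ~ countable (W `&` [set x | col x = e] `&` [set x | k x = i]).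
  move=> e; have [ge|] := pselect (good e); last by exists (fun=> (e, 0)).
  have [||k kP] := @uncountable_partition _ _ _ _ _ P _ J (K e) (e, 0) _ (nW _ ge).
  - exact: measurableI.
  - by split=> //; have [_ re] := rP _ ge.
  - by exists k.
pose k x := ke (col x) x.
pose B (i : J) := W `&` [set x | k x = i].
have kK x : W x -> good (k x).1 /\ lab (k x) = col x.
  by move=> Wx; have [/(_ x)] := keP (col x) (ex_intro2 _ _ x Wx erefl).
have BE i : good i.1 ->
    B i = W `&` [set x | col x = lab i] `&` [set x | ke (lab i) x = i].
  move=> gi; apply/seteqP; split=> x.
    move=> [Wx /= kx]; have [_] := kK x Wx; rewrite kx => li.
    by split; [split|rewrite /= li].
  by move=> [[Wx /= cx] /= kx]; split=> //=; rewrite /k cx.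
have mB i : measurable (B i).
  have [gi|ngi] := pselect (good i.1).
    by rewrite (BE _ gi); have [_ /(_ i)[]] := keP _ (good_lab _ gi).
  rewrite (_ : B i = set0)//; apply/seteqP; split=> // x [Wx /= ki].
  by apply: ngi; rewrite -ki; have [] := kK _ Wx.
(* An isomorphism of X onto each piece, with its inverse. *)
have /choice[th thP] : forall i, exists th : (X -> X) * (X -> X),
    [/\ measurable_fun setT th.1, measurable_fun setT th.2 &
    good i.1 -> [/\ cancel th.1 th.2, forall x, B i (th.1 x) &
      forall x, B i x -> th.1 (th.2 x) = x] ].
  move=> i; have [gi|ngi] := pselect (good i.1); last first.
    by exists (id, id); split=> //; exact: measurable_id.
  have nB : ~ countable (B i).
    by rewrite (BE _ gi); have [_ /(_ i)[]] := keP _ (good_lab _ gi).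
  have [f [g [mf mg fK fB gK]]] := borel_isomorphism P (mB i) nB.
  by exists (f, g).
pose sh (i : J) (m : int) : J := (i.1, i.2 + m).
(* All powers of S are defined at once: that Sm is an action of the integers then
   gives the inverse of S, and its orbits. *)
pose Sm (m : int) x :=
  if `[< W x >] then (th (sh (k x) m)).1 ((th (k x)).2 x) else aut_expz T m x.
have SmE m x : W x -> Sm m x = (th (sh (k x) m)).1 ((th (k x)).2 x).
  by move=> Wx; rewrite /Sm; case: asboolP.
have SmW m x : W x -> [/\ W (Sm m x), k (Sm m x) = sh (k x) m &
    (th (sh (k x) m)).2 (Sm m x) = (th (k x)).2 x].
  move=> Wx; rewrite (SmE _ _ Wx); have [gk _] := kK x Wx.
  have [_ _ /(_ gk)[thK thB _]] := thP (sh (k x) m).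
  by rewrite thK; case: (thB ((th (k x)).2 x)).
have SmM m x : M x -> Sm m x = aut_expz T m x by move=> Mx; rewrite /Sm; case: asboolP.
have Sm0 x : Sm 0 x = x.
  rewrite /Sm; case: asboolP => [Wx|//]; rewrite /sh addr0 -surjective_pairing.
  by have [gk _] := kK x Wx; have [_ _ /(_ gk)[_ _]] := thP (k x); apply.
have SmD m n x : Sm (m + n) x = Sm m (Sm n x).
  have [Mx|Wx] := pselect (M x).
    by rewrite !(SmM _ _ Mx) SmM ?aut_expzD//; exact/MT.
  have [Wn kn tn] := SmW n x Wx.
  rewrite (SmE _ _ Wx) (SmE m _ Wn) kn tn; congr ((th _).1 _).
  by rewrite /sh /= addrAC addrA.
have mSm m : measurable_fun setT (Sm m).
  pose F (i : option J) x := if i is Some i then (th (sh i m)).1 ((th i).2 x)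
    else aut_expz T m x.
  rewrite (_ : Sm m = fun x => F (if `[< W x >] then Some (k x) else None) x); last first.
    by apply/funext => x; rewrite /Sm; case: ifP.
  apply: measurable_fun_glue => [[i|]|[i|]].
  - rewrite (_ : [set x | _] = B i)//; apply/seteqP; split=> x /=.
      by case: asboolP => // Wx [].
    by move=> [Wx /= <-]; case: asboolP.
  - rewrite (_ : [set x | _] = ~` W); first exact: measurableC.
    by apply/seteqP; split=> x /=; case: asboolP.
  - by apply: (measurableT_comp (f := (th (sh i m)).1));
      [case: (thP (sh i m))|case: (thP i)].
  - exact: measurable_aut_fun.
have SmK m : cancel (Sm m) (Sm (- m)) by move=> x; rewrite -SmD addNr.
have SmK' m : cancel (Sm (- m)) (Sm m) by move=> x; rewrite -SmD subrr.
pose S := BorelAut (SmK 1) (SmK' 1) (mSm 1) (mSm (- 1)).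
have SE n x : aut_expz S n x = Sm n x.
  rewrite -[in LHS](Sm0 x); apply: (@aut_expz_seq _ _ S (fun n => Sm n x)) => m.
  by rewrite addrC SmD.
have orbM x : M x -> aut_orbit S x = aut_orbit T x.
  by move=> Mx; apply/seteqP; split=> _ [n _ <-]; exists n => //; rewrite SE SmM.
exists S; split.
- exists ([set x | W x /\ (k x).2 = 0] `|` [set x | M x /\ x = get (aut_orbit T x)]).
    apply: measurableU.
      rewrite (_ : [set x | _] = \bigcup_e B (e, 0)).
        exact: measurable_bigcupT.
      apply/seteqP; split=> [x [Wx k0]|x [e _ [Wx /= ->]]] //.
      by exists (k x).1 => //; split=> //=; rewrite -k0 -surjective_pairing.
    apply: (measurable_countable P); apply: sub_countable cM.
    by apply: subset_card_le => x [].
  (* On M the transversal picks a point that only depends on the orbit as a set. *)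
  move=> x; have [Mx|Wx] := pselect (M x).
    have xx : aut_orbit T x x by exists 0.
    have [n _ ny] : aut_orbit T x (get (aut_orbit T x)) by exact: getI xx.
    exists (get (aut_orbit T x)); split.
      split; last by rewrite orbM//; exact: getI xx.
      by right; rewrite -ny; split; [exact/MT|rewrite aut_orbit_expz -ny].
    move=> y [+ Oy]; move: Oy; rewrite orbM// => -[m _ <-] [[/(_ _)[]]|[_ ->]].
      exact/MT.
    by rewrite aut_orbit_expz.
  (* On W the place (k x).2 of a point is translated by n under the n-th power. *)
  exists (Sm (- (k x).2) x); split.
    have [Wm km _] := SmW (- (k x).2) x Wx; split;
      last by exists (- (k x).2) => //; rewrite SE.
    by left; split=> //; rewrite km /= subrr.
  move=> y [+ [n _ yE]]; rewrite -{}yE SE => Ay.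
  have [Wn kn _] := SmW n x Wx; case: Ay => [[_]|[/Wn]//].
  by rewrite kn /= => /eqP; rewrite addrC addr_eq0 => /eqP ->.
- move=> x; rewrite -[aut_fun S x]/(Sm 1 x); have [Mx|Wx] := pselect (M x).
    by rewrite SmM// (@aut_funK _ _ T).
  have [W1 k1 _] := SmW 1 x Wx; have [_ l1] := kK _ W1; have [_ l0] := kK _ Wx.
  have := congr1 snd l1; have := congr1 fst l0; rewrite k1 /= => <- <-.
  by rewrite aut_expzS (@aut_funK _ _ T).
- move=> aT x; have [Mx|Wx] := pselect (M x); first by rewrite orbM.
  move=> fO; apply: infinite_nat.
  have := finite_image (fun y => `|(k y).2 - (k x).2|%N) fO; congr finite_set.
  apply/seteqP; split=> // n _; exists (Sm n%:Z x); first by exists n%:Z => //; rewrite SE.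
  by have [_ -> _] := SmW n%:Z x Wx; rewrite /= addrAC subrr add0r.
Qed.

End SmoothModification.

Theorem theorem3p2 (R : realType) (d : measure_display) (X : measurableType d)
    (X_standard : standard_borel R X) (X_uncountable : ~ countable [set: X]) :
  closure (smooth X) = [set: borel_aut X] /\
  (forall T : borel_aut X, aperiodic X T ->
     forall V : set (borel_aut X), nbhs T V ->
       exists S : borel_aut X, [/\ V S, aperiodic X S & smooth X S]).
Proof.
have key (T : borel_aut X) (V : set (borel_aut X)) : nbhs T V ->
    exists S : borel_aut X, [/\ V S, smooth X S & aperiodic X T -> aperiodic X S].
  move=> /p_nbhsP[n [F [mF FV]]].
  have [dist [q P]] := standard_borel_polish X_standard.
  pose a x : {ffun 'I_n -> bool} := [ffun i => `[< F (val i) x >]].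
  have [|S [smS aS apS]] := @smooth_modification _ _ _ _ _ P T _ a.
    move=> l; rewrite (_ : [set x | _] =
      \bigcap_i [set x | `[< F (val (i : 'I_n)) x >] = l i]).
      apply: measurable_bigcapT => i.
      rewrite (_ : [set x | _] = if l i then F (val i) else ~` F (val i)).
        by case: ifP => _; [|apply: measurableC]; exact: (mF _ (ltn_ord i)).
      by apply/seteqP; case: (l i); split=> x /=; case: asboolP.
    apply/seteqP; split=> [x /= <- i _|x al] /=; first by rewrite ffunE.
    by apply/ffunP => i; rewrite ffunE; exact: al.
  exists S; split=> //; apply: FV => i lin; apply/seteqP.
  have FS x : F i (aut_inv T (S x)) <-> F i x.
    have /ffunP/(_ (Ordinal lin)) := aS x; rewrite !ffunE /= => h.
    by split=> Fx; apply/asboolP; [rewrite -h|rewrite h]; apply/asboolP.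
  split=> [_ [x Fx <-]|_ [x Fx <-]].
    by exists (aut_inv T (S x)); [exact/FS|rewrite aut_invK].
  exists (aut_inv S (T x)); last by rewrite aut_invK.
  by apply/FS; rewrite aut_invK aut_funK.
split; last by move=> T aT V /key[S [VS smS /(_ aT)]]; exists S.
apply/seteqP; split=> // T _ V /key[S [VS smS _]]; by exists S.
Qed.
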